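(* Let $X$ be a Banach space having the relatively compact Dunford-Pettis property (DPrcP). Then $X$ has the L-Dunford-Pettis property if and only if $X$ is reflexive.
   Context: $X'$ denotes the topological dual of the Banach space $X$. A norm bounded subset $A$ of $X$ is called Dunford-Pettis (DP) if every weakly null sequence $(f_n)$ in $X'$ satisfies $\lim_{n\to\infty}\sup_{x\in A}|f_n(x)|=0$. A sequence $(x_n)$ ''is a DP set'' if the set $\{x_n : n\in\mathbb{N}\}$ is a DP set. A Banach space $X$ has the relatively compact Dunford-Pettis property (DPrcP) if every Dunford-Pettis set in $X$ is relatively (norm) compact. A norm bounded subset $A$ of $X'$ is called an L-Dunford-Pettis set if every weakly null sequence $(x_n)$ in $X$ which is a DP set in $X$ satisfies $\lim_{n\to\infty}\sup_{f\in A}|f(x_n)|=0$. A Banach space $X$ has the L-Dunford-Pettis property if every L-Dunford-Pettis set in $X'$ is relatively weakly compact. *)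

(* Defs.v *)
From HB Require Import structures.
From mathcomp Require Import all_boot all_order all_algebra.
From mathcomp Require Import all_classical all_reals all_analysis.

Set Implicit Arguments.
Unset Strict Implicit.
Unset Printing Implicit Defensive.

Import Order.TTheory GRing.Theory Num.Theory.
Import numFieldNormedType.Exports.

Local Open Scope classical_set_scope.
Local Open Scope ring_scope.

Section Dual.
Context {R : realType}.
Implicit Type X : normedModType R.

Definition continuous_linear X : {pred X -> R^o} :=
  fun f => `[< linear f /\ continuous f >].

Lemma continuous_linear_submod_closed X :
  submod_closed (@continuous_linear X).
Proof.
split.
  apply/asboolP; split; last exact: cst_continuous.
  by move=> a x y /=; rewrite scaler0 addr0.
move=> a f g /asboolP[lf cf] /asboolP[lg cg]; apply/asboolP; split.
  move=> b x y; rewrite [LHS]/(a *: f (b *: x + y) + g (b *: x + y)).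
  rewrite [RHS]/(b *: (a *: f x + g x) + (a *: f y + g y)) lf lg.
  rewrite !scalerDr !scalerA (mulrC a b).
  exact: addrACA.
move=> x; apply: (@continuousD _ _ _ (a \*: f) g); last exact: cg.
by apply: continuousZr; exact: cf.
Qed.

HB.instance Definition _ X :=
  GRing.isSubmodClosed.Build R (X -> R^o) (@continuous_linear X)
    (continuous_linear_submod_closed X).

Record dual X := Dual {
  dual_fun :> X -> R^o;
  dual_funP : dual_fun \in @continuous_linear X }.

HB.instance Definition _ X := [isSub for @dual_fun X].
HB.instance Definition _ X := [Choice of dual X by <:].
HB.instance Definition _ X := [SubChoice_isSubLmodule of dual X by <:].

Lemma dual_linear X (f : dual X) : linear f.
Proof. by have /asboolP[] := dual_funP f. Qed.

Lemma dual_continuous X (f : dual X) : continuous f.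
Proof. by have /asboolP[] := dual_funP f. Qed.

HB.instance Definition _ X (f : dual X) :=
  GRing.isLinear.Build R X R^o *:%R (dual_fun f) (dual_linear f).

Definition dual_norm X (f : dual X) : R :=
  sup [set `|f x| | x in [set x : X | `|x| <= 1]].

Lemma dual_norm_has_sup X (f : dual X) :
  has_sup [set `|f x| | x in [set x : X | `|x| <= 1]].
Proof.
split; first by exists `|f 0|, 0 => //=; rewrite normr0.
have /bounded_funP/(_ 1)[M fM] :=
  (linear_bounded_continuous f).2 (@dual_continuous _ f).
by exists M => _ [x x1 <-]; exact: fM.
Qed.

Lemma dual_norm_ge0 X (f : dual X) : 0 <= dual_norm f.
Proof.
apply: sup_upper_bound; first exact: dual_norm_has_sup.
by exists 0 => /=; rewrite ?linear0 normr0.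
Qed.

Lemma le_dual_norm X (f : dual X) (x : X) : `|f x| <= dual_norm f * `|x|.
Proof.
have [->|x0] := eqVneq x 0; first by rewrite linear0 !normr0 mulr0.
have nx0 : 0 < `|x| by rewrite normr_gt0.
have : `|f (`|x|^-1 *: x)| <= dual_norm f.
  apply: sup_upper_bound; first exact: dual_norm_has_sup.
  exists (`|x|^-1 *: x) => //=.
  by rewrite normrZ normfV normr_id mulVf// gt_eqF.
by rewrite linearZ/= normrZ normfV normr_id mulrC ler_pdivrMr.
Qed.

Lemma dual_norm_le X (f : dual X) (M : R) :
  (forall x, `|x| <= 1 -> `|f x| <= M) -> dual_norm f <= M.
Proof.
move=> fM; apply: ge_sup; first by have [] := dual_norm_has_sup f.
by move=> _ [x x1 <-]; exact: fM.
Qed.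

Lemma ler_dual_normD X (f g : dual X) :
  dual_norm (f + g) <= dual_norm f + dual_norm g.
Proof.
apply: dual_norm_le => x x1; rewrite (le_trans (ler_normD _ _))// lerD//.
  by rewrite (le_trans (le_dual_norm _ _))// ler_piMr// dual_norm_ge0.
by rewrite (le_trans (le_dual_norm _ _))// ler_piMr// dual_norm_ge0.
Qed.

Lemma dual_normZ X (a : R) (f : dual X) :
  dual_norm (a *: f) = `|a| * dual_norm f.
Proof.
have le_normZ b (g : dual X) : dual_norm (b *: g) <= `|b| * dual_norm g.
  apply: dual_norm_le => x x1; rewrite [leLHS]normrZ ler_wpM2l//.
  by rewrite (le_trans (le_dual_norm _ _))// ler_piMr// dual_norm_ge0.
apply/eqP; rewrite eq_le le_normZ/=.
have [->|a0] := eqVneq a 0; first by rewrite normr0 mul0r dual_norm_ge0.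
rewrite -ler_pdivlMl ?normr_gt0// -normfV.
by have := le_normZ a^-1 (a *: f); rewrite scalerA mulVf// scale1r.
Qed.

Lemma dual_norm0_eq0 X (f : dual X) : dual_norm f = 0 -> f = 0.
Proof.
move=> f0; apply/val_inj/funext => x /=; apply/eqP; rewrite -normr_le0.
by have := le_dual_norm f x; rewrite f0 mul0r.
Qed.

HB.instance Definition _ X :=
  Lmodule_isNormed.Build R (dual X) (@ler_dual_normD X) (@dual_normZ X)
    (@dual_norm0_eq0 X).

Lemma evaluation_continuous_linear X (x : X) :
  (fun f : dual X => f x) \in @continuous_linear (dual X).
Proof.
have lx : linear (fun f : dual X => f x) by [].
pose ev : {linear dual X -> R^o} :=
  HB.pack (fun f : dual X => f x) (GRing.isLinear.Build _ _ _ _ _ lx).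
apply/asboolP; split => //.
apply: (bounded_linear_continuous (f := ev)); apply/bounded_funP => r.
exists (r * `|x|) => f fr.
by rewrite (le_trans (le_dual_norm f x))// ler_wpM2r.
Qed.

Definition canonical_embedding X (x : X) : dual (dual X) :=
  Dual (evaluation_continuous_linear x).

Definition reflexive_space X : Prop :=
  range (@canonical_embedding X) = setT.

(* The coarsest topology on X making every element of the dual continuous:
   the one induced from pointwise convergence on the dual. *)
Definition weak X : Type :=
  initial_topology (fun x : X => (fun f => f x) : {ptws dual X -> R^o}).

HB.instance Definition _ X := Topological.copy (weak X)
  (initial_topology (fun x : X => (fun f => f x) : {ptws dual X -> R^o})).

Definition weakly_null X (x : nat -> X) : Prop :=
  (x : nat -> weak X) @ \oo --> ((0 : X) : weak X).

(* As A is norm bounded, each set of values below has an upper bound, so [sup]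
   is the genuine supremum; on the empty set [sup] is 0. *)
Definition dunford_pettis X (A : set X) : Prop :=
  bounded_set A /\
  forall f : nat -> dual X, weakly_null f ->
    sup [set `|f n x| | x in A] @[n --> \oo] --> (0 : R).

Definition l_dunford_pettis X (A : set (dual X)) : Prop :=
  bounded_set A /\
  forall x : nat -> X, weakly_null x -> dunford_pettis (range x) ->
    sup [set `|f (x n)| | f in A] @[n --> \oo] --> (0 : R).

Definition relatively_weakly_compact X (A : set X) : Prop :=
  precompact (A : set (weak X)).

Definition DPrcP X : Prop :=
  forall A : set X, dunford_pettis A -> precompact A.

Definition l_dunford_pettis_property X : Prop :=
  forall A : set (dual X), l_dunford_pettis A -> relatively_weakly_compact A.

End Dual.

(* Main.v *)
From HB Require Import structures.
Require Import Defs.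
From mathcomp Require Import all_boot all_order all_algebra.
From mathcomp Require Import all_classical all_reals all_analysis.
From mathcomp Require Import ring lra.

(** In a space [X] with the relatively compact Dunford-Pettis property, a weakly
    null sequence that is a Dunford-Pettis set has relatively compact range, so
    it is norm null: any cluster point is annihilated by every functional.
    Hence every bounded subset of the dual is an L-Dunford-Pettis set
    ([l_dunford_pettis_bounded]), and the L-Dunford-Pettis property amounts to
    the relative weak compactness of the bounded subsets of the dual.

    If [X] is reflexive, the weak topology of the dual is that of pointwise
    convergence on [X], and bounded sets are relatively compact by the
    Banach-Alaoglu theorem ([reflexive_dual_ball_compact]).

    Conversely, suppose that the unit ball [B] of the dual is relatively weakly
    compact, and let [phi] be in the bidual. By compactness, [phi] restricted to
    [B] is continuous at the origin for pointwise convergence on [X]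
    ([ball_pointwise_small]): some finite part [s] of [X] is such that
    [`|phi f| < e] as soon as [f] is in [B] and [`|f x| <= 1] on [s]. On the
    annihilator of [s] the norm of [phi] is thus at most [e]; the Hahn-Banach
    theorem gives a functional of norm at most [e] that agrees with [phi] there,
    and the difference, which vanishes on the annihilator of a finite set, is
    the evaluation at a point of [X]. So [phi] is a limit of evaluations
    ([bidual_approx]). As [X] is complete and embeds isometrically, [phi] is
    itself an evaluation.

    The Hahn-Banach theorem is proved by showing that a minimal sublinear
    functional is linear; minimal ones exist by Zorn's lemma, and prescribed
    values are obtained by first taking an infimal convolution. *)

Set Implicit Arguments.
Unset Strict Implicit.
Unset Printing Implicit Defensive.

Import Order.TTheory GRing.Theory Num.Theory.
Import numFieldNormedType.Exports.

Local Open Scope classical_set_scope.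
Local Open Scope ring_scope.

(** * The Hahn-Banach theorem *)

Section HahnBanach.
Context {R : realType} {V : lmodType R}.
Implicit Types (p q g : V -> R) (C : set V) (x y z : V).

(** Sublinear functionals; only one inequality is asked of positive
    homogeneity, as the other one follows. *)
Definition sublinear p : Prop :=
  (forall x y, p (x + y) <= p x + p y) /\
  (forall t x, 0 <= t -> p (t *: x) <= t * p x).

Lemma sublinear0 p : sublinear p -> p 0 = 0.
Proof.
move=> [pD pZ]; apply/eqP; rewrite eq_le; apply/andP; split.
  by have := pZ 0 0 (lexx _); rewrite scaler0 mul0r.
by have := pD 0 0; rewrite addr0; lra.
Qed.

Lemma sublinearN p x : sublinear p -> - p (- x) <= p x.
Proof.
move=> sp; have := sp.1 x (- x); rewrite subrr sublinear0//; lra.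
Qed.

Lemma sublinearZ p t x : sublinear p -> 0 <= t -> p (t *: x) = t * p x.
Proof.
move=> sp t0; apply/eqP; rewrite eq_le sp.2//=.
have [t_eq0|tN0] := eqVneq t 0.
  by rewrite t_eq0 mul0r scale0r sublinear0.
have tp : 0 < t by rewrite lt_neqAle eq_sym tN0.
have := sp.2 t^-1 (t *: x); rewrite scalerA mulVf// scale1r invr_ge0 => /(_ t0).
by rewrite ler_pdivlMl.
Qed.

Lemma linear_funZ (f : V -> R^o) a x : linear f -> f (a *: x) = a * f x.
Proof.
move=> lf; pose h : {linear V -> R^o} :=
  HB.pack f (GRing.isLinear.Build _ _ _ _ f lf).
exact: (linearZ_LR h).
Qed.

Lemma linear_funN (f : V -> R^o) x : linear f -> f (- x) = - f x.
Proof. by move=> lf; rewrite -scaleN1r linear_funZ// mulN1r. Qed.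

Lemma le_mul_inf (S : set R) (a t : R) : S !=set0 -> 0 <= t ->
  (forall s, S s -> a <= t * s) -> a <= t * inf S.
Proof.
move=> S0 t0 aS; have [t_eq0|tN0] := eqVneq t 0.
  by case: S0 => s /aS; rewrite t_eq0 !mul0r.
have tp : 0 < t by rewrite lt_neqAle eq_sym tN0.
rewrite mulrC -ler_pdivrMr//; apply: lb_le_inf => // s Ss.
by rewrite ler_pdivrMr// mulrC aS.
Qed.

(** The infimal convolution of [p] with [g], where [g] is taken to be [+oo]
    outside of [C]. *)
Definition inf_convolution p C g x : R := inf [set p (x - y) + g y | y in C].

(** The infimal convolution is sublinear, and lies below [p] everywhere and
    below [g] on the convex cone [C]. The last hypothesis keeps the infimum
    finite. *)
Lemma sublinear_inf_convolution p C g : sublinear p ->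
  C 0 -> (forall y z, C y -> C z -> C (y + z)) ->
  (forall t y, 0 <= t -> C y -> C (t *: y)) ->
  (forall y z, C y -> C z -> g (y + z) <= g y + g z) ->
  (forall t y, 0 <= t -> C y -> g (t *: y) <= t * g y) ->
  (forall y, C y -> - p (- y) <= g y) ->
  [/\ sublinear (inf_convolution p C g),
      forall x, inf_convolution p C g x <= p x &
      forall y, C y -> inf_convolution p C g y <= g y].
Proof.
move=> sp C0 CD CZ gD gZ pg; set q := inf_convolution p C g; have [pD pZ] := sp.
have S0 x : [set p (x - y) + g y | y in C] !=set0.
  by exists (p (x - 0) + g 0), 0.
have q_le x y : C y -> q x <= p (x - y) + g y.
  move=> Cy; apply: ge_inf; last by exists y.
  exists (- p (- x)) => _ [z Cz <-].
  have := pD (x - z) (- x); rewrite addrAC subrr add0r.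
  by have := pg _ Cz; lra.
have q_ge x a : (forall y, C y -> a <= p (x - y) + g y) -> a <= q x.
  by move=> h; apply: lb_le_inf => // _ [y Cy <-]; exact: h.
split.
- split.
  + move=> x y; rewrite -lerBlDr; apply: (q_ge) => z Cz.
    rewrite lerBlDr -lerBlDl; apply: (q_ge) => w Cw; rewrite lerBlDl.
    apply: (le_trans (q_le _ _ (CD _ _ Cz Cw))).
    have := gD _ _ Cz Cw; have := pD (x - z) (y - w).
    by rewrite addrACA -opprD; lra.
  + move=> t x t0; apply: le_mul_inf => // _ [y Cy <-].
    apply: (le_trans (q_le _ _ (CZ _ _ t0 Cy))).
    by rewrite -scalerBr mulrDr lerD ?pZ ?gZ.
- move=> x; apply: (le_trans (q_le x _ C0)); rewrite subr0.
  have := gZ 0 0 (lexx _) C0; rewrite scaler0 mul0r; lra.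
- move=> y Cy; apply: (le_trans (q_le _ _ Cy)).
  by rewrite subrr sublinear0// add0r.
Qed.

(** A sublinear functional can be lowered so that its value at [- y] is at most
    [- p y]: the infimal convolution is taken over the half-line spanned by
    [- y], with [g (- (t *: y)) = - (t * p y)]. *)
Lemma sublinear_tangent p y : sublinear p ->
  exists q, [/\ sublinear q, forall x, q x <= p x & q (- y) <= - p y].
Proof.
move=> sp; have [pD pZ] := sp.
have [y0|yN0] := eqVneq y 0.
  by exists p; split => //; rewrite y0 oppr0 sublinear0// oppr0.
pose C := [set z | exists2 t, 0 <= t & z = - (t *: y)].
have t_inj t s : - (t *: y) = - (s *: y) -> t = s.
  move=> /oppr_inj /eqP; rewrite -subr_eq0 -scalerBl scaler_eq0 (negbTE yN0).
  by rewrite orbF subr_eq0 => /eqP.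
(* [g] is defined by the coefficient of its argument along [- y]; off the
   half-line its value is irrelevant. *)
pose coef z : R := xget 0 [set t | z = - (t *: y)].
have coefE t : coef (- (t *: y)) = t.
  by rewrite /coef; case: xgetP => [s _ /= /esym/t_inj//|/(_ t) /= h]; case: h.
pose g z := - (coef z * p y).
have gE t : g (- (t *: y)) = - (t * p y) by rewrite /g coefE.
have [|_ _ [t t0 ->] [s s0 ->]|s _ s0 [t t0 ->]|_ _ [t t0 ->] [s s0 ->]
     |s _ s0 [t t0 ->]|_ [t t0 ->]|sq qp qg] :=
  @sublinear_inf_convolution p C g sp.
- by exists 0 => //; rewrite scale0r oppr0.
- by exists (t + s); rewrite ?addr_ge0// scalerDl opprD.
- by exists (s * t); rewrite ?mulr_ge0// scalerN scalerA.
- by rewrite -opprD -scalerDl !gE mulrDl opprD.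
- by rewrite scalerN scalerA !gE mulrN mulrA.
- by rewrite gE opprK sublinearZ.
exists (inf_convolution p C g); split => //.
have := qg (- y); rewrite -[in g _](scale1r y) gE mul1r; apply.
by exists 1 => //; rewrite scale1r.
Qed.

(** A linear minorant is obtained as a minimal sublinear functional. *)
Lemma exists_linear_le p : sublinear p ->
  exists f : V -> R^o, linear f /\ forall x, f x <= p x.
Proof.
move=> sp; pose T := {q : V -> R | sublinear q /\ forall x, q x <= p x}.
pose le_T (q r : T) := `[< forall x, sval r x <= sval q x >].
have [||||[q [sq qp]] qmin] := @Zorn T le_T.
- by move=> q; exact/asboolP.
- move=> q r s /asboolP qr /asboolP rs; apply/asboolP => x.
  exact: le_trans (rs x) (qr x).
- move=> [q qP] [r rP] /asboolP qr /asboolP rq; apply/eq_exist/funext => x.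
  by apply/eqP; rewrite eq_le; apply/andP; split; [exact: rq|exact: qr].
(* A chain is bounded by its pointwise infimum, or by [p] if it is empty. *)
- move=> A Atot; have [A0|] := pselect (A !=set0); last first.
    move=> /set0P/negP/negPn/eqP ->.
    by exists (exist _ p (conj sp (fun x => lexx _))) => s.
  pose S x := [set sval q x | q in A].
  have S0 x : S x !=set0 by case: A0 => q Aq; exists (sval q x), q.
  have S_ge x : has_lbound (S x).
    exists (- p (- x)) => _ [[q [sq qp]] Aq <-] /=.
    by apply: le_trans (sublinearN x sq); rewrite lerN2.
  pose m x := inf (S x).
  have m_le x (q : T) : A q -> m x <= sval q x.
    by move=> Aq; apply: ge_inf => //; exists q.
  have sm : sublinear m.
    split.
      move=> x y; rewrite -lerBlDr; apply: lb_le_inf => // _ [q Aq <-].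
      rewrite lerBlDr -lerBlDl; apply: lb_le_inf => // _ [r Ar <-].
      rewrite lerBlDl.
      have [/asboolP qr|/asboolP rq] := Atot _ _ Aq Ar.
        apply: (le_trans (m_le _ _ Ar)).
        by have := (svalP r).1.1 x y; have := qr x; lra.
      apply: (le_trans (m_le _ _ Aq)).
      by have := (svalP q).1.1 x y; have := rq y; lra.
    move=> t x t0; apply: le_mul_inf => // _ [q Aq <-].
    exact: le_trans (m_le _ _ Aq) ((svalP q).1.2 _ _ t0).
  have mp x : m x <= p x.
    by case: A0 => q Aq; exact: le_trans (m_le _ _ Aq) ((svalP q).2 x).
  by exists (exist _ m (conj sm mp)) => q Aq; apply/asboolP => x; exact: m_le.
(* By minimality, lowering [q] as in [sublinear_tangent] changes nothing. *)
have qN y : q (- y) = - q y.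
  have [r [sr rq ry]] := sublinear_tangent y sq.
  have rp x : r x <= p x by exact: le_trans (rq x) (qp x).
  have /(congr1 sval)/= rqE := qmin (exist _ r (conj sr rp)) (asboolT rq).
  apply/eqP; rewrite eq_le -{1}rqE ry/=.
  by have := sublinearN (- y) sq; rewrite opprK; lra.
have qD x y : q (x + y) = q x + q y.
  apply/eqP; rewrite eq_le sq.1/=.
  have := sq.1 (x + y) (- y); rewrite addrK qN; lra.
exists q; split => // t x y; rewrite qD; congr (_ + _).
have [t0|t0] := leP 0 t; first exact: sublinearZ.
rewrite -[t]opprK scaleNr qN sublinearZ ?oppr_ge0 ?ltW//.
by rewrite mulNr opprK opprK.
Qed.

(** At any given point, some linear minorant of [p] takes the same value as
    [p]. *)
Lemma linear_minorant_eq p y : sublinear p ->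
  exists f : V -> R^o, [/\ linear f, forall x, f x <= p x & f y = p y].
Proof.
move=> sp; have [q [sq qp qy]] := sublinear_tangent y sp.
have [f [lf fq]] := exists_linear_le sq.
have fp x : f x <= p x by exact: le_trans (fq x) (qp x).
exists f; split => //; apply/eqP; rewrite eq_le fp/=.
by have := le_trans (fq (- y)) qy; rewrite linear_funN// lerN2.
Qed.

(** The dominated extension theorem; [N] is a linear subspace, and only the
    restriction of [g] to [N] matters. *)
Lemma dominated_extension p (N : set V) (g : V -> R^o) :
  sublinear p -> linear g ->
  N 0 -> (forall a x y, N x -> N y -> N (a *: x + y)) ->
  (forall x, N x -> g x <= p x) ->
  exists f : V -> R^o,
    [/\ linear f, forall x, f x <= p x & forall x, N x -> f x = g x].
Proof.
move=> sp lg N0 NL gp.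
have NZ a x : N x -> N (a *: x) by move=> Nx; rewrite -[_ *: _]addr0; exact: NL.
have [//|x y Nx Ny|t x _ Nx|x y Nx Ny|t x _ Nx|x Nx|sq qp qg] :=
  @sublinear_inf_convolution p N g sp.
- by rewrite -[x]scale1r; exact: NL.
- exact: NZ.
- by rewrite -[x in x + _]scale1r lg scale1r.
- by rewrite linear_funZ.
- by rewrite lerNl -linear_funN// -scaleN1r; apply: gp; exact: NZ.
have [f [lf fq]] := exists_linear_le sq.
exists f; split => // [x|x Nx]; first exact: le_trans (fq x) (qp x).
have f_le z : N z -> f z <= g z by move=> Nz; exact: le_trans (fq z) (qg _ Nz).
apply/eqP; rewrite eq_le f_le//=.
by have := f_le (- x); rewrite !linear_funN// lerN2; apply;
  rewrite -scaleN1r; exact: NZ.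
Qed.

End HahnBanach.

(** * Functionals, the canonical embedding and the weak topology *)

Section DualSpace.
Context {R : realType} {X : normedModType R}.

(** Bounded linear functionals belong to the dual. *)
Lemma dualP (f : X -> R^o) (M : R) : linear f ->
  (forall x, `|f x| <= M * `|x|) -> exists g : dual X, forall x, g x = f x.
Proof.
move=> lf fM.
pose h : {linear X -> R^o} := HB.pack f (GRing.isLinear.Build _ _ _ _ f lf).
suff cf : f \in @continuous_linear R X by exists (Dual cf).
apply/asboolP; split => //.
apply: (bounded_linear_continuous (f := h)); apply/bounded_funP => r.
exists (`|M| * `|r|) => x xr; apply: (le_trans (fM x)).
apply: (@le_trans _ _ (`|M| * `|x|)); first by rewrite ler_wpM2r// ler_norm.
by rewrite ler_wpM2l// (le_trans xr)// ler_norm.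
Qed.

Lemma dual_norm_leP (f : dual X) (M : R) : 0 <= M ->
  (forall x, `|f x| <= M * `|x|) <-> `|f| <= M.
Proof.
move=> M0; split=> [fM|fM x].
  apply: dual_norm_le => x x1; apply: (le_trans (fM x)).
  by rewrite ler_piMr.
by apply: (le_trans (le_dual_norm f x)); rewrite ler_wpM2r.
Qed.

Lemma dualDE (f g : dual X) x : (f + g) x = f x + g x. Proof. by []. Qed.

Lemma dualZE (a : R) (f : dual X) x : (a *: f) x = a * f x. Proof. by []. Qed.

Lemma dual_ext (f g : dual X) : (forall x, f x = g x) -> f = g.
Proof. by move=> fg; apply/val_inj/funext. Qed.

End DualSpace.

Section CanonicalEmbedding.
Context {R : realType} {X : normedModType R}.

Lemma exists_norming_functional (x : X) :
  exists f : dual X, (forall y, `|f y| <= `|y|) /\ f x = `|x|.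
Proof.
have [|f [lf fle fx]] := @linear_minorant_eq R X (fun y => `|y|) x.
  split; first exact: ler_normD.
  by move=> t y t0; rewrite normrZ ger0_norm.
have f_le y : `|f y| <= `|y|.
  by rewrite ler_norml fle andbT lerNl -linear_funN// -(normrN y).
have [|g gf] := dualP (M := 1) lf; first by move=> y; rewrite mul1r.
by exists g; split=> [y|]; rewrite gf.
Qed.

Lemma canonical_embeddingB (x y : X) :
  canonical_embedding (x - y) = canonical_embedding x - canonical_embedding y.
Proof. by apply: dual_ext => f; exact: linearB. Qed.

Lemma norm_canonical_embedding (x : X) : `|canonical_embedding x| = `|x|.
Proof.
apply/eqP; rewrite eq_le; apply/andP; split.
  apply: dual_norm_le => f f1; apply: (le_trans (le_dual_norm f x)).
  by rewrite ler_piMl.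
have [f [fle fx]] := exists_norming_functional x.
have f1 : `|f| <= 1.
  by apply: dual_norm_le => y y1; exact: le_trans (fle y) y1.
have := le_dual_norm (canonical_embedding x) f.
rewrite /= fx ger0_norm// => /le_trans; apply.
by rewrite ler_piMr// dual_norm_ge0.
Qed.

Lemma dual_separates (x : X) : (forall f : dual X, f x = 0) -> x = 0.
Proof.
move=> fx0; have [f [_ fx]] := exists_norming_functional x.
by apply/eqP; rewrite -normr_eq0 -fx fx0.
Qed.

(** A filter converges weakly iff it does so along each functional. *)
Lemma weak_cvgP (F : set_system (weak X)) (x : X) : Filter F ->
  F --> (x : weak X) <-> forall f : dual X, (f : X -> R^o) @ F --> f x.
Proof.
move=> FF; pose J : weak X -> {ptws dual X -> R^o} := fun y f => f y.
have cJ : continuous J by exact: initial_continuous.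
split=> [Fx f|Fx].
  have FJ : J @ F --> J x by apply: cvg_trans (cvg_app J Fx) _; exact: cJ.
  exact: (pointwise_cvgP _ _).1 FJ f.
have FJ : J @ F --> J x by apply/pointwise_cvgP => f; exact: Fx.
move=> A /= [B [[C oC <-] Cx] CA].
apply: filterS CA _; apply: FJ; exact: open_nbhs_nbhs.
Qed.

End CanonicalEmbedding.

(** A proper filter on a relatively compact set has a convergent refinement. *)
Lemma precompact_finer {T : topologicalType} (A : set T) (F : set_system T) :
  precompact A -> ProperFilter F -> F A ->
  exists (x : T) (G : set_system T), [/\ ProperFilter G, F `<=` G & G --> x].
Proof.
move=> [U AU [cU _]] PF FA.
have [x [_]] := cU F PF (filterS AU FA).
by rewrite cluster_cvgE => -[G PG [Gx FG]]; exists x, G.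
Qed.

(** A weakly null sequence with relatively norm compact range is norm null. *)
Lemma weakly_null_precompact {R : realType} {X : normedModType R}
    (x : nat -> X) :
  weakly_null x -> precompact (range x) -> x @ \oo --> (0 : X).
Proof.
move=> x0 cx; apply/cvgr0Pnorm_lt => e e0; apply: contrapT => xe.
(* If the sequence is not norm null, it stays away from [0] along the proper
   filter [within D \oo]; a limit point [y] of it is annihilated by the dual. *)
pose D := [set n | e <= `|x n|].
have PF : ProperFilter (within D \oo).
  apply: Build_ProperFilter_ex => P DP; apply: contrapT => Pn; apply: xe.
  have {}DP : \forall n \near \oo, D n -> P n by exact: DP.
  apply: filterS DP => n DPn; rewrite ltNge; apply/negP => Dn.
  by apply: Pn; exists n; exact: DPn.
have [|y [G [PG FG Gy]]] :=
  @precompact_finer X (range x) (x @ within D \oo) cx _.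
  by apply: filterS (@filterT _ (within D \oo) _) => n _; exists n.
have y0 : y = 0.
  apply: dual_separates => f.
  have Gf : (f : X -> R^o) @ G --> (f y : R^o).
    by apply: cvg_comp Gy _; exact: dual_continuous.
  have Gf0 : (f : X -> R^o) @ G --> (0 : R^o).
    have [/(_ x0 f) + _] := @weak_cvgP R X (x @ \oo) 0 _.
    rewrite linear0 => h A /h hA; apply: FG.
    have {}hA : \forall n \near \oo, A (f (x n)) by exact: hA.
    by apply: (@filterS _ \oo _ _ (fun n => D n -> A (f (x n))) _ hA) => n An _.
  exact: cvg_unique Gf Gf0.
have GD : G [set z | e <= `|z|].
  by apply: FG; apply: (@filterE _ \oo _ (fun n => D n -> e <= `|x n|)).
have Gb : G [set z | `|z| < e].
  by move: Gy; rewrite y0 => /cvgr0_norm_lt; exact.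
have [z [/= ez ze]] := filter_ex (filterI GD Gb).
by move: (le_lt_trans ez ze); rewrite ltxx.
Qed.

(** * Bounded sets of functionals as L-Dunford-Pettis sets *)

(** For a space with the relatively compact Dunford-Pettis property, bounded
    subsets of the dual are L-Dunford-Pettis sets. *)
Lemma l_dunford_pettis_bounded {R : realType} {X : normedModType R}
    (A : set (dual X)) :
  DPrcP X -> bounded_set A -> l_dunford_pettis A.
Proof.
move=> hX bA; split => // x x0 /hX/(weakly_null_precompact x0) x_cvg0.
have [M M0 AM] := pinfty_ex_gt0 bA.
have fM f y : A f -> `|f y| <= M * `|y|.
  by move=> Af; move: y; apply/dual_norm_leP; [exact: ltW|exact: AM].
have [->|/set0P[f0 Af0]] := eqVneq A set0.
  by under eq_fun do rewrite image_set0 sup0; exact: cvg_cst.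
apply: (@squeeze_cvgr _ _ _ _ (fun=> 0) (fun n => M * `|x n|)).
- near=> n; apply/andP; split.
    apply: (@le_trans _ _ `|f0 (x n)|) => //.
    apply: ub_le_sup; last by exists f0.
    by exists (M * `|x n|) => _ [f Af <-]; exact: fM.
  apply: ge_sup; first by exists `|f0 (x n)|, f0.
  by move=> _ [f Af <-]; exact: fM.
- exact: cvg_cst.
- rewrite -(mulr0 M); apply: cvgMr; rewrite -(@normr0 _ X).
  exact: cvg_norm.
Unshelve. all: by end_near. Qed.

(** * Weak compactness of the dual ball and reflexivity *)

Section Bidual.
Context {R : realType} {X : normedModType R}.
Implicit Types (phi : dual (dual X)) (s : seq X).

(** If the unit ball of the dual is relatively weakly compact, then on it every
    element of the bidual is continuous at the origin for the topology of
    pointwise convergence on the space. *)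
Lemma ball_pointwise_small phi (e : R) :
  relatively_weakly_compact [set f : dual X | `|f| <= 1] -> 0 < e ->
  exists s, forall f : dual X,
    `|f| <= 1 -> (forall x, x \in s -> `|f x| <= 1) -> `|phi f| < e.
Proof.
move=> cB e0; apply: contrapT => noS.
(* Otherwise the sets [S s] generate a proper filter on the ball. A weak limit
   [g] of a refinement vanishes, as [S [:: d^-1 *: x]] forces [`|f x| <= d];
   but [phi] stays away from [0] on [S s]. *)
pose S s := [set f : dual X | [/\ `|f| <= 1,
  forall x, x \in s -> `|f x| <= 1 & e <= `|phi f|]].
have S0 s : S s !=set0.
  apply: contrapT => Ss; apply: noS; exists s => f f1 fs.
  by rewrite ltNge; apply/negP => ef; apply: Ss; exists f.
pose F : set_system (weak (dual X)) := filter_from setT S.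
have FF : Filter F.
  apply: filter_from_filter; first by exists [::].
  move=> s t _ _; exists (s ++ t) => // f [f1 fst ef].
  by split; split => // x xs; apply: fst; rewrite mem_cat xs ?orbT.
have PF : ProperFilter F by apply: filter_from_proper.
have FB : F [set f : dual X | `|f| <= 1] by exists [::] => // f [].
have [g [G [PG FG Gg]]] := @precompact_finer (weak (dual X)) _ F cB PF FB.
have /weak_cvgP Gcvg := Gg.
have g0 : (g : dual X) = 0.
  apply: dual_ext => x.
  have Gx0 : (fun f : dual X => f x : R^o) @ G --> (0 : R^o).
    apply/cvgr0Pnorm_le => d d0; apply: FG.
    exists [:: d^-1 *: x] => // f [_ + _] /=.
    move=> /(_ (d^-1 *: x)); rewrite mem_head linearZ/= => /(_ isT).
    by rewrite normrZ gtr0_norm ?invr_gt0// ler_pdivrMl// mulr1.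
  exact: cvg_unique (Gcvg (canonical_embedding x)) Gx0.
have Gphi : G [set f : dual X | `|phi f| < e].
  have := Gcvg phi; rewrite g0 linear0 => /cvgr0_norm_lt; exact.
have Ge : G [set f : dual X | e <= `|phi f|].
  by apply: FG; exists [::] => // f [].
have [f [/= fe ef]] := filter_ex (filterI Gphi Ge).
by move: (le_lt_trans ef fe); rewrite ltxx.
Qed.

(** A functional on the dual that vanishes where finitely many evaluations
    vanish is a linear combination of them, hence an evaluation. *)
Lemma evaluation_of_vanishing s (h : dual X -> R^o) : linear h ->
  (forall f : dual X, (forall x, x \in s -> f x = 0) -> h f = 0) ->
  exists y : X, forall f, h f = f y.
Proof.
elim: s h => [|x s IHs] h lh h0.
  by exists 0 => f; rewrite linear0 h0.
have [[f0 [f0s f0x]]|noF] := pselect (exists f0 : dual X,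
    (forall z, z \in s -> f0 z = 0) /\ f0 x != 0); last first.
  apply: IHs => // f fs; apply: h0 => z.
  rewrite inE => /orP[/eqP ->|/fs //]; apply/eqP/negPn/negP => fx.
  by apply: noF; exists f.
pose c := h f0 / f0 x.
(* Subtracting a multiple of the evaluation at [x] makes [h] vanish where the
   evaluations on [s] do, whatever the value at [x]. *)
have hc : linear ((fun f => h f - c * f x) : dual X -> R^o).
  move=> a f g; rewrite lh dualDE dualZE.
  have scE (b : R^o) : a *: b = a * b by [].
  rewrite !scE; lra.
have [f fs|y hy] := IHs _ hc; last first.
  exists (c *: x + y) => f; have := hy f.
  by rewrite linearP/= => <-; rewrite addrC subrK.
pose u : dual X := f - (f x / f0 x) *: f0.
have uE z : u z = f z - (f x / f0 x) * f0 z by [].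
have : h u = 0.
  apply: h0 => z; rewrite inE uE => /orP[/eqP ->|zs].
    by rewrite divfK ?subrr.
  by rewrite (f0s z)// (fs z)// mulr0 subrr.
have -> : u = (- (f x / f0 x)) *: f0 + f by rewrite scaleNr addrC.
rewrite lh => <-; have -> : forall b v : R^o, b *: v = b * v by [].
by rewrite /c; ring.
Qed.

(** Approximation of the elements of the bidual by evaluations. *)
Lemma bidual_approx phi (e : R) :
  relatively_weakly_compact [set f : dual X | `|f| <= 1] -> 0 < e ->
  exists y : X, `|phi - canonical_embedding y| <= e.
Proof.
move=> cB e0; have [s phis] := ball_pointwise_small phi cB e0.
pose N := [set f : dual X | forall x, x \in s -> f x = 0].
have phiN f : N f -> `|phi f| <= e * `|f|.
  move=> Nf; have [->|fN0] := eqVneq f 0.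
    by rewrite linear0 !normr0 mulr0.
  have nf0 : 0 < `|f| by rewrite normr_gt0.
  have : `|phi (`|f|^-1 *: f)| < e.
    apply: phis; first by rewrite normrZ normfV normr_id mulVf// gt_eqF.
    move=> x xs; by rewrite dualZE Nf// mulr0 normr0.
  rewrite linearZ normrZ gtr0_norm ?invr_gt0// ltr_pdivrMl// mulrC.
  exact: ltW.
have [||||h [lh hle hN]] :=
  @dominated_extension R (dual X) (fun f => e * `|f|) N phi _ (dual_linear phi).
- split=> [f g|t f t0]; first by rewrite -mulrDr ler_wpM2l ?ler_normD// ltW.
  by rewrite normrZ ger0_norm// mulrCA.
- by [].
- move=> a f g Nf Ng x xs.
  by rewrite dualDE dualZE Nf// Ng// mulr0 addr0.
- by move=> f Nf; exact: le_trans (ler_norm _) (phiN f Nf).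
have ld : linear ((fun f => phi f - h f) : dual X -> R^o).
  by move=> a f g; rewrite lh linearP/= scalerBr opprD addrACA.
have [f fs|y hy] := evaluation_of_vanishing (s := s) ld.
  by rewrite hN ?subrr.
exists y; apply/dual_norm_leP; first exact: ltW.
move=> f; have -> : (phi - canonical_embedding y) f = h f.
  have -> : (phi - canonical_embedding y) f = phi f - f y by [].
  by rewrite -hy subKr.
by rewrite ler_norml hle andbT lerNl -linear_funN// -(normrN f).
Qed.

End Bidual.

(** The range of the canonical embedding of a complete space is closed: the
    points whose images approach [phi] form a Cauchy filter, the embedding being
    isometric. *)
Lemma canonical_embedding_range_closed {R : realType}
    {X : completeNormedModType R} (phi : dual (dual X)) :
  (forall e : R, 0 < e -> exists y : X, `|phi - canonical_embedding y| <= e) ->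
  exists y : X, canonical_embedding y = phi.
Proof.
move=> phi_approx.
pose S (e : R) := [set y : X | `|phi - canonical_embedding y| <= e].
pose F : set_system X := filter_from [set e : R | 0 < e] S.
have FF : Filter F.
  apply: filter_from_filter; first by exists 1 => /=.
  move=> d e /= d0 e0; exists (Num.min d e); first by rewrite /= lt_min d0.
  by move=> y /= ; rewrite /S/= le_min => /andP[].
have PF : ProperFilter F by apply: filter_from_proper => // e /= /phi_approx.
have : cauchy F.
  apply: cauchy_exP => e e0; have e30 : 0 < e / 3 by rewrite divr_gt0.
  have [y ye] := phi_approx _ e30.
  exists y; exists (e / 3) => // z /= ze.
  rewrite -ball_normE /ball_/= -norm_canonical_embedding canonical_embeddingB.
  rewrite -(subrKA phi) addrC.
  apply: (le_lt_trans (ler_normD _ _)); rewrite (distrC _ phi).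
  by rewrite /S/= in ze; lra.
move=> /cauchy_cvg /cvg_ex[y Fy]; exists y; apply: dual_ext => f.
have Fphi : (f : X -> R^o) @ F --> (phi f : R^o).
  apply/cvgrPdist_le => e e0.
  exists (e / (`|f| + 1)); first by rewrite /= divr_gt0// ltr_wpDl.
  move=> z; rewrite /S/= => zp.
  have -> : phi f - f z = (phi - canonical_embedding z) f by [].
  apply: (le_trans (le_dual_norm _ _)).
  apply: (@le_trans _ _ (e / (`|f| + 1) * `|f|)); first by rewrite ler_wpM2r.
  rewrite mulrAC ler_pdivrMr ?ltr_wpDl// ler_wpM2l ?ltW//.
  by rewrite ltrDl.
have Ff : (f : X -> R^o) @ F --> (f y : R^o).
  by apply: cvg_comp Fy _; exact: dual_continuous.
exact: cvg_unique Ff Fphi.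
Qed.

(** Banach-Alaoglu, in the case where the weak and the weak-star topologies of
    the dual agree. *)
Lemma reflexive_dual_ball_compact {R : realType} {X : normedModType R} (M : R) :
  reflexive_space X -> 0 <= M ->
  relatively_weakly_compact [set f : dual X | `|f| <= M].
Proof.
move=> rX M0; set B := [set f : dual X | _].
have evE (phi : dual (dual X)) : exists x, forall f, phi f = f x.
  have : range (@canonical_embedding R X) phi by rewrite rX.
  by move=> [x _ <-]; exists x.
have lim_le (F : set_system (weak (dual X))) (g : X -> R^o) : ProperFilter F ->
    (forall x, (fun f : dual X => f x : R^o) @ F --> (g x : R^o)) -> F B ->
    forall x, `|g x| <= M * `|x|.
  move=> PF Fg FB x.
  apply: (@closed_cvg _ _ F PF (fun f : dual X => f x : R^o)
    (fun y => `|y| <= M * `|x|)).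
  - by apply: (@closed_comp _ _ (fun y : R^o => `|y|) [set y | y <= M * `|x|]);
      [move=> y _; exact: norm_continuous|exact: closed_le].
  - by apply: filterS FB => f Bf; exact: (dual_norm_leP f M0).2.
  - exact: Fg.
exists B => //; split; last first.
  move=> g Bg; have PG : ProperFilter (within B (nbhs (g : weak (dual X)))).
    apply: Build_ProperFilter_ex => P /Bg[f [Bf /(_ Bf)]]; by exists f.
  apply/dual_norm_leP => //; apply: (lim_le _ _ PG) => [x|];
    last exact: withinT.
  have /weak_cvgP := @cvg_id _ (nbhs (g : weak (dual X))).
  move=> /(_ (canonical_embedding x)) h; apply: cvg_trans h.
  by apply: cvg_app; exact: cvg_within.
rewrite compact_ultra => F UF FB.
(* The pointwise limits along an ultrafilter exist by compactness of segments,
   and form a bounded linear functional. *)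
have Fcvg x : exists y : R, (fun f : dual X => f x : R^o) @ F --> (y : R^o).
  pose E := (fun f : dual X => f x : R^o) @ F.
  have EI : E [set` `[- (M * `|x|), M * `|x|]].
    apply: (@filterS _ F _ B) FB => f Bf.
    by have := (dual_norm_leP f M0).2 Bf x; rewrite ler_norml /= in_itv.
  have [y [_ Ey]] := @segment_compact R _ _ E _ EI.
  exists y => V yV.
  have [//|FV] := in_ultra_setVsetC ((fun f : dual X => f x : R^o) @^-1` V) UF.
  by have [z [nVz Vz]] := Ey (~` V) V FV yV.
pose g x : R^o :=
  xget 0 [set y : R | (fun f : dual X => f x : R^o) @ F --> (y : R^o)].
have Fg x : (fun f : dual X => f x : R^o) @ F --> g x.
  by rewrite /g; case: xgetP => [//|h]; have [y /h] := Fcvg x.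
have lg : linear g.
  move=> a x y; apply: (cvg_unique _ (Fg _)) => //.
  have -> : (fun f : dual X => f (a *: x + y) : R^o) =
      (fun f : dual X => a *: (f x : R^o) + (f y : R^o)).
    by apply/funext => f; rewrite linearP.
  by apply: cvgD (Fg y); apply: cvgZr; exact: Fg.
have [|g' g'E] := dualP (M := M) lg.
  exact: lim_le Fg FB.
exists g'; split; first by apply/dual_norm_leP => // x;
  rewrite g'E; exact: lim_le Fg FB x.
apply/weak_cvgP => phi; have [x phix] := evE phi.
rewrite phix g'E (_ : (phi : dual X -> R^o) = (fun f => f x)); first exact: Fg.
exact/funext.
Qed.

Theorem corollary2p10 (R : realType) (X : completeNormedModType R)
    (hX : DPrcP X) :
  l_dunford_pettis_property X <-> reflexive_space X.
Proof.
split=> [LX|rX A [bA _]].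
  have cB : relatively_weakly_compact [set f : dual X | `|f| <= 1].
    apply: LX; apply: l_dunford_pettis_bounded => //.
    by exists 1; split=> // M M1 f /= f1; exact: le_trans f1 (ltW M1).
  apply/seteqP; split=> // phi _.
  have [|y <-] := @canonical_embedding_range_closed _ _ phi; last by exists y.
  by move=> e e0; exact: bidual_approx.
have [M M0 AM] := pinfty_ex_gt0 bA.
apply: precompact_subset (reflexive_dual_ball_compact rX (ltW M0)).
exact: AM.
Qed.
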